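(* Consider an instance of the Oven Scheduling Problem (OSP) and any feasible solution of it. Let $r\in\mathcal{A}$ be an attribute, let $b_r$ be the number of batches with attribute $r$ in the solution, and let $p_r$ be the sum of the processing times of the batches with attribute $r$ in the solution. Let $C=\max_{m\in\mathcal{M}} c_m$. Then $$b_r\ \ge\ |J_r^l| + GACb(J_r^s,C),\qquad p_r\ \ge\ \sum_{j\in J_r^l} mint_j + GACp(J_r^s,C),$$ where the sets $J_r^l,J_r^s$ of large and small jobs of attribute $r$ and the quantities $GACb$, $GACp$ are as defined in the context.
   Context: OSP instance. A finite set $\mathcal{M}=\{1,\dots,k\}$ of machines, a finite set $\mathcal{J}=\{1,\dots,n\}$ of jobs, a set $\mathcal{A}=\{1,\dots,a\}$ of attributes, and a scheduling horizon length $l\in\mathbb{N}$. Each machine $m$ has a capacity $c_m$ (a positive integer), an initial state $s_m\in\mathcal{A}$, and $I$ availability intervals $[as(m,i),ae(m,i)]\subseteq[0,l]$, $1\le i\le I$, with $as(m,i)\le ae(m,i)\le as(m,i+1)$. Each job $j$ has a set $\mathcal{E}_j\subseteq\mathcal{M}$ of eligible machines, an earliest start time $et_j\in\mathbb{N}$ with $0\le et_j<l$, a latest end time $lt_j\in\mathbb{N}$ with $et_j<lt_j\le l$, natural numbers $0<mint_j\le maxt_j$ (minimal and maximal processing time), a size $s_j\in\mathbb{N}$, and an attribute $a_j\in\mathcal{A}$. There are $a\times a$ matrices of non-negative integer setup times $st(\cdot,\cdot)$ and setup costs $sc(\cdot,\cdot)$, indexed by ordered pairs of attributes (not necessarily symmetric).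 Feasible solution. Jobs are partitioned into non-empty batches; each batch is assigned to a machine, and the batches on machine $m$ are ordered $B_{m,1},\dots,B_{m,b_m}$ ($b_m$ is the number of batches on $m$). Each batch $B_{m,b}$ has an integer start time $S_{m,b}\in[0,l]$, and its processing time is $P_{m,b}=\max_{j\in B_{m,b}} mint_j$. For every batch $B_{m,b}$ and all $j\in B_{m,b}$: $m\in\mathcal{E}_j$; $S_{m,b}\ge et_j$; $P_{m,b}\le maxt_j$. All jobs in a batch have the same attribute, which is the attribute $A_{m,b}$ of the batch. The total size satisfies $\sum_{j\in B_{m,b}}s_j\le c_m$. Consecutive batches satisfy $S_{m,b}+P_{m,b}+st(A_{m,b},A_{m,b+1})\le S_{m,b+1}$. Each batch together with its preceding setup lies within one availability interval: for each $m,b$ there is $i$ with $S_{m,b}+P_{m,b}\le ae(m,i)$ and $as(m,i)\le S_{m,b}-st(A',A_{m,b})$, where $A'=A_{m,b-1}$ if $b\ge2$ and $A'=s_m$ if $b=1$. (Due dates $lt_j$ need not be met.) Large and small jobs. $J_r^l=\{j\in\mathcal{J}: a_j=r \text{ and } \max_{m\in\mathcal{E}_j}c_m - s_j<\min_{i\in\mathcal{J}:a_i=r}s_i\}$, and $J_r^s=\{j\in\mathcal{J}:a_j=r\}\setminus J_r^l$. Algorithm GAC+ (input: a finite set of unit size jobs, each with $mint_j\le maxt_j$, and a batch size limit $c\ge1$). Consider the jobs in non-increasing order of $mint_j$, ties broken arbitrarily. Repeatedly, until all jobs are placed, open a new batch, let $j^*$ be the first job in this order not yet placed, and, starting with $j^*$,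 place into the batch the first $c$ not yet placed jobs $j$ with $mint_{j^*}\in[mint_j,maxt_j]$ (or all of them if there are fewer than $c$). The processing time of a batch is the maximum of $mint_j$ over its jobs. For a set $J$ of jobs of arbitrary sizes, $GACb(J,c)$ denotes the number of batches, and $GACp(J,c)$ the sum of batch processing times, returned by GAC+ with batch size limit $c$ when every job $j\in J$ is replaced by $s_j$ identical unit size copies (each with the same $mint_j$ and $maxt_j$). These values do not depend on how ties are broken. *)

(* Defs.v *)
From HB Require Import structures.
From mathcomp Require Import all_boot all_order all_algebra.

Set Implicit Arguments.
Unset Strict Implicit.
Unset Printing Implicit Defensive.

(* An instance with machines 'I_k, jobs 'I_n, attributes 'I_a, availability
   intervals indexed by 'I_q on each machine, and horizon length l.
   Start times and processing times are integers, but the end points of the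
   availability intervals may be arbitrary elements of the ordered field R. *)
Record instance (R : realFieldType) (k n a q l : nat) := Instance {
  capacity : 'I_k -> nat;
  capacity_gt0 : forall m, 0 < capacity m;
  init_state : 'I_k -> 'I_a;
  avail_start : 'I_k -> 'I_q -> R;
  avail_end : 'I_k -> 'I_q -> R;
  avail_start_ge0 : forall m i, (0 <= avail_start m i)%R;
  avail_end_le : forall m i, (avail_end m i <= l%:R)%R;
  avail_start_le_end : forall m i, (avail_start m i <= avail_end m i)%R;
  avail_end_le_next : forall m (i i' : 'I_q), i' = i.+1 :> nat ->
    (avail_end m i <= avail_start m i')%R;
  eligible : 'I_n -> {set 'I_k};
  earliest_start : 'I_n -> nat;
  earliest_start_lt : forall j, earliest_start j < l;
  latest_end : 'I_n -> nat;
  latest_end_bounds : forall j, earliest_start j < latest_end j <= l;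
  mint : 'I_n -> nat;
  maxt : 'I_n -> nat;
  proc_time_bounds : forall j, 0 < mint j <= maxt j;
  jsize : 'I_n -> nat;
  jattr : 'I_n -> 'I_a;
  setup_time : 'M[nat]_a;
  setup_cost : 'M[nat]_a
}.

Record batch (n a : nat) := Batch {
  bjobs : {set 'I_n};
  bstart : nat;
  battr : 'I_a
}.

Lemma batch_tupleK n a :
  cancel (fun B : batch n a => (bjobs B, bstart B, battr B))
         (fun t => Batch t.1.1 t.1.2 t.2).
Proof. by case. Qed.

HB.instance Definition _ n a :=
  Equality.copy (batch n a) (can_type (@batch_tupleK n a)).

(* The ordered list of batches on each machine. *)
Definition solution (k n a : nat) := 'I_k -> seq (batch n a).

Definition all_batches k n a (sol : solution k n a) : seq (batch n a) :=
  flatten [seq sol m | m <- enum 'I_k].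

Definition ptime R k n a q l (o : instance R k n a q l) (B : batch n a) : nat :=
  \max_(j in bjobs B) mint o j.

(* The decompositions sol m = p ++ B :: s range over the positions of the
   batches on machine m; the state of the machine just before the setup for B
   is the attribute of the last batch of p, or the initial state if p is
   empty. *)
Record feasible R k n a q l (o : instance R k n a q l) (sol : solution k n a) :
    Prop := Feasible {
  feas_nonempty : forall m B, B \in sol m -> bjobs B != set0;
  feas_partition : forall j : 'I_n,
    count (fun B => j \in bjobs B) (all_batches sol) = 1;
  feas_horizon : forall m B, B \in sol m -> bstart B <= l;
  feas_eligible : forall m B j, B \in sol m -> j \in bjobs B ->
    m \in eligible o j;
  feas_start : forall m B j, B \in sol m -> j \in bjobs B ->
    earliest_start o j <= bstart B;
  feas_maxt : forall m B j, B \in sol m -> j \in bjobs B ->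
    ptime o B <= maxt o j;
  feas_attr : forall m B j, B \in sol m -> j \in bjobs B ->
    jattr o j = battr B;
  feas_capacity : forall m B, B \in sol m ->
    \sum_(j in bjobs B) jsize o j <= capacity o m;
  feas_consecutive : forall m p B B' s, sol m = p ++ B :: B' :: s ->
    bstart B + ptime o B + setup_time o (battr B) (battr B') <= bstart B';
  feas_available : forall m p B s, sol m = p ++ B :: s ->
    exists i : 'I_q,
      ((bstart B + ptime o B)%:R <= avail_end o m i)%R /\
      (avail_start o m i <= (bstart B)%:R -
         (setup_time o (last (init_state o m) [seq battr B' | B' <- p])
                       (battr B))%:R)%R
}.

Definition num_batches k n a (sol : solution k n a) (r : 'I_a) : nat :=
  count (fun B => battr B == r) (all_batches sol).

Definition total_ptime R k n a q l (o : instance R k n a q l)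
    (sol : solution k n a) (r : 'I_a) : nat :=
  \sum_(B <- all_batches sol | battr B == r) ptime o B.

Definition max_capacity R k n a q l (o : instance R k n a q l) : nat :=
  \max_(m < k) capacity o m.

(* Starting the iteration of minn from the largest job size makes this the
   minimum as soon as some job has attribute r. *)
Definition min_size R k n a q l (o : instance R k n a q l) (r : 'I_a) : nat :=
  \big[minn / (\max_(i < n) jsize o i)]_(i < n | jattr o i == r) jsize o i.

(* The inequality max c_m - s_j < min s_i, with s_j moved to the right because
   subtraction on nat is truncated. *)
Definition large_jobs R k n a q l (o : instance R k n a q l) (r : 'I_a) :
    {set 'I_n} :=
  [set j | (jattr o j == r) &&
           (\max_(m in eligible o j) capacity o m < jsize o j + min_size o r)].

Definition small_jobs R k n a q l (o : instance R k n a q l) (r : 'I_a) :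
    {set 'I_n} :=
  [set j | jattr o j == r] :\: large_jobs o r.

(* The first c elements of s satisfying p (all of them if there are fewer),
   and what remains of s, both in the order of s. *)
Fixpoint extract (T : Type) (p : pred T) (c : nat) (s : seq T) :
    seq T * seq T :=
  if s is x :: s' then
    if (0 < c) && p x then
      let: (t, u) := extract p c.-1 s' in (x :: t, u)
    else
      let: (t, u) := extract p c s' in (t, x :: u)
  else ([::], [::]).

(* The batches formed by GAC+ from the list s of unit size jobs, assumed to be
   in non-increasing order of mint. Each round removes at least the head of s,
   so fuel = size s is enough to place all jobs. *)
Fixpoint gac_rec (T : Type) (mint maxt : T -> nat) (c fuel : nat) (s : seq T) :
    seq (seq T) :=
  if fuel is fuel'.+1 then
    if s is j :: s' then
      let: (t, u) := extract (fun i => mint i <= mint j <= maxt i) c.-1 s' in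
      (j :: t) :: gac_rec mint maxt c fuel' u
    else [::]
  else [::].

Definition gac (T : Type) (mint maxt : T -> nat) (c : nat) (s : seq T) :
    seq (seq T) :=
  gac_rec mint maxt c (size s) s.

Definition unit_copies R k n a q l (o : instance R k n a q l)
    (J : {set 'I_n}) : seq 'I_n :=
  flatten [seq nseq (jsize o j) j | j <- enum J].

(* s lists the unit size copies of the jobs of J in an order in which GAC+ may
   consider them: such an s amounts to a choice of how ties are broken. *)
Definition gac_order R k n a q l (o : instance R k n a q l)
    (J : {set 'I_n}) (s : seq 'I_n) : bool :=
  perm_eq s (unit_copies o J) && sorted (fun i j => mint o j <= mint o i) s.

(* GACb(J, c) and GACp(J, c), computed with the order s of the copies of J. *)
Definition GACb R k n a q l (o : instance R k n a q l) (c : nat)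
    (s : seq 'I_n) : nat :=
  size (gac (mint o) (maxt o) c s).

Definition GACp R k n a q l (o : instance R k n a q l) (c : nat)
    (s : seq 'I_n) : nat :=
  \sum_(B <- gac (mint o) (maxt o) c s) \max_(j <- B) mint o j.

(* Main.v *)
Require Import Defs.
From mathcomp Require Import all_boot all_order all_algebra.

(** A batch containing a large job contains no other job, so the large jobs
    account for batches of their own.  The remaining batches, with every job
    replaced by unit size copies, form a solution of a unit size problem, for
    which GAC+ is optimal: the first job j in the order determines the
    processing time of its batch, and if x precedes y and both fit into
    the batch of j, then y can take the place of x in any batch whose
    processing time is at most mint j.  Hence the batch of j can be exchanged
    for the one formed by GAC+. *)

(** * Optimality of GAC+ for unit size jobs *)

Section UnitJobs.

Set Implicit Arguments.
Unset Strict Implicit.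
Unset Printing Implicit Defensive.

Variables (T I : eqType) (mint maxt : T -> nat).
Implicit Types (s v O : seq T) (A : seq (T * I)) (pt : I -> nat).

Let nonincr := fun i j => mint j <= mint i.

Lemma nonincr_trans : transitive nonincr.
Proof. by move=> y x z xy yz; apply: leq_trans yz xy. Qed.

Lemma extract_subseq (p : pred T) c s : subseq (extract p c s).2 s.
Proof.
elim: s c => // x s IHs c; rewrite [extract _ _ _]/=; case: ifP => _.
  have := IHs c.-1; case: (extract p c.-1 s) => t u /= us.
  exact: subseq_trans us (subseq_cons s x).
by have := IHs c; case: (extract p c s) => t u us; rewrite /= eqxx.
Qed.

Lemma extract_all (p : pred T) c s : all p (extract p c s).1.
Proof.
elim: s c => // x s IHs c /=; case: ifP => [/andP[_ px]|_].
  by have := IHs c.-1; case: (extract p c.-1 s) => t u /= ->; rewrite px.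
by have := IHs c; case: (extract p c s).
Qed.

(* A pair (x, i) places the unit size job x in the slot i, a batch of
   processing time pt i. *)
Definition fits pt (z : T * I) := mint z.1 <= pt z.2 <= maxt z.1.

(* O is what the given solution still has in the batch that is being filled by
   extract, A places all other jobs, and v lists the jobs skipped so far. *)
Lemma extract_exchange pt P c s v O A :
    (forall i, pt i <= P) -> sorted nonincr s ->
    all (fun i => mint i <= P <= maxt i) O -> size O <= c ->
    {in O, forall y, y \notin v} -> all (fits pt) A ->
    perm_eq (O ++ unzip1 A) (v ++ s) ->
  exists A', [/\ perm_eq (unzip1 A')
                   (v ++ (extract (fun i => mint i <= P <= maxt i) c s).2),
    all (fits pt) A' &
    forall i, count_mem i (unzip2 A') <= count_mem i (unzip2 A)].
Proof.
move=> ptP; set p := fun i => _.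
elim: s c v O A => [|x s IHs] c v O A sort_s pO szO Ov fA eqA.
  (* With [s] exhausted, [O] is empty: any job left in it would lie in [v]. *)
  exists A; split=> //=; case: O => // y O in pO szO Ov eqA *.
  have : y \in v by have := perm_mem eqA y; rewrite cats0 !inE eqxx /= => <-.
  by rewrite (negbTE (Ov y _)) // mem_head.
have sort_s' := subseq_sorted nonincr_trans (subseq_cons s x) sort_s.
rewrite /=; case: ifP => [/andP[c_gt0 px]|px].
  case E: (extract p c.-1 s) => [t u] /=.
  have -> : u = (extract p c.-1 s).2 by rewrite E.
  have eqvx : perm_eq (v ++ x :: s) (x :: (v ++ s)).
    by rewrite perm_catC /= perm_cons perm_catC.
  have [xO|xO] := boolP (x \in O).
    have eqO := perm_to_rem xO.
    apply: (IHs _ _ (rem x O)) => //.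
    - by apply/allP=> y /mem_rem /(allP pO).
    - by rewrite size_rem // -!subn1 leq_sub2r.
    - by move=> y /mem_rem; apply: Ov.
    - rewrite -(perm_cons x) -(permPr eqvx) -(permPr eqA) -cat_cons.
      by rewrite perm_cat2r perm_sym.
  have : x \in unzip1 A.
    have := perm_mem eqA x.
    by rewrite !mem_cat (negbTE xO) inE eqxx orbT.
  case/mapP=> -[x' i] xiA /= exx'; subst x'.
  have eqA1 := perm_to_rem xiA; set A1 := rem (x, i) A in eqA1.
  have fA1 : all (fits pt) ((x, i) :: A1) by rewrite -(perm_all _ eqA1).
  have [fxi {}fA1] := andP fA1.
  have eq1 : perm_eq (O ++ unzip1 A1) (v ++ s).
    rewrite -(perm_cons x) -(permPr eqvx) -(permPr eqA).
    have := perm_map fst eqA1; rewrite -(perm_cat2l O) => /permPr ->.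
    by rewrite -cat1s perm_catCA.
  have cntA h : count_mem h (unzip2 A) = (i == h) + count_mem h (unzip2 A1).
    by have /permP -> := perm_map snd eqA1.
  (* The batch being filled takes [x] out of slot [i]. If [O] is empty, the slot just loses a job.
     Otherwise some [y] in [O] moves there: it comes after [x], so
     [mint y <= mint x <= pt i <= P <= maxt y]. *)
  case: O => [|y O] in pO szO Ov eqA xO eq1 *.
    have [] // := IHs c.-1 v [::] A1 => A' [? ? cA'].
    by exists A'; split=> // h; rewrite cntA (leq_trans (cA' h)) ?leq_addl.
  have ys : y \in s.
    have := perm_mem eq1 y.
    by rewrite !mem_cat mem_head (negbTE (Ov y _)) ?mem_head.
  have yx : mint y <= mint x.
    by move: sort_s; rewrite /= (path_sortedE nonincr_trans) => /andP[/allP/(_ y ys)].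
  have [|||||A' [? ? cA']] := IHs c.-1 v O ((y, i) :: A1) sort_s'.
  - by case/andP: pO.
  - by rewrite -ltnS prednK.
  - by move=> z zO; apply: Ov; rewrite inE zO orbT.
  - apply/andP; split=> //; move: fxi; rewrite /fits /= => /andP[xi _].
    rewrite (leq_trans yx xi) (leq_trans (ptP i)) //.
    by case/andP: pO => /andP[].
  - by rewrite /= -(permPr eq1) -cat1s perm_catCA.
  by exists A'; split=> // h; rewrite cntA (leq_trans (cA' h)).
case E: (extract p c s) => [t u] /=.
have -> : u = (extract p c s).2 by rewrite E.
have eqvx w : perm_eq (v ++ x :: w) ((x :: v) ++ w) by rewrite -cat1s perm_catCA.
(* A skipped [x] is not in [O]: members of [O] satisfy [p], and a nonempty [O] forces [0 < c]. *)
have [|//||A' [eA' ? cA']] := IHs c (x :: v) O A sort_s' pO szO.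
- move=> y yO; rewrite inE negb_or Ov // andbT; apply/eqP=> eyx.
  move: px; rewrite -eyx (allP pO y yO) andbT.
  by case: O yO szO {pO Ov eqA} => //= z O _ /(leq_trans (ltn0Sn _)) ->.
- exact: perm_trans eqA (eqvx s).
by exists A'; split=> //=; apply: perm_trans eA' _; rewrite perm_sym.
Qed.

(** Each round rebuilds the slot of the head [j] as the batch of GAC+, then deletes this slot from
    [E]. Since slots are shortened on the way, [pt] varies in the induction. *)
Lemma gac_rec_optimal c fuel s pt A (E : seq I) :
    sorted nonincr s -> perm_eq (unzip1 A) s -> all (fits pt) A ->
    {in A, forall z, z.2 \in E} -> (forall i, count_mem i (unzip2 A) <= c) ->
  size (gac_rec mint maxt c fuel s) <= size E /\
  \sum_(B <- gac_rec mint maxt c fuel s) \max_(j <- B) mint j <=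
    \sum_(i <- E) pt i.
Proof.
elim: fuel s pt A E => [|fuel IH] [|j s] pt A E sort_s eqA fA AE cA;
  rewrite /= ?big_nil //.
set p := fun i => mint i <= mint j <= maxt i.
have maxj x : x \in j :: s -> mint x <= mint j.
  rewrite inE => /predU1P[-> //|xs].
  by move: sort_s; rewrite /= (path_sortedE nonincr_trans) => /andP[/allP/(_ x xs)].
have sort_s' := subseq_sorted nonincr_trans (subseq_cons s j) sort_s.
(* Slots longer than mint j may be shortened, as no remaining job needs more. *)
pose pt' i := minn (pt i) (mint j).
have fA' : all (fits pt') A.
  apply/allP=> z zA; move: (allP fA z zA); rewrite /fits /pt' => /andP[h1 h2].
  have : z.1 \in j :: s by rewrite -(perm_mem eqA) map_f.
  by move/maxj=> mz; rewrite leq_min h1 mz (leq_trans (geq_minl _ _) h2).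
have : j \in unzip1 A by rewrite (perm_mem eqA) mem_head.
case/mapP=> -[j' i0] jA /= ejj'; subst j'.
have i0E : i0 \in E by apply: (AE _ jA).
pose in0 := fun z : T * I => z.2 == i0.
(* The companions of [j] in its slot [i0] will be the set [O] of the exchange; [A1] holds the jobs
   of the other slots. *)
pose A0 := rem (j, i0) (filter in0 A).
pose A1 := filter (predC in0) A.
have jA0 : (j, i0) \in filter in0 A by rewrite mem_filter jA /in0 /= eqxx.
(* As [j] fits into [i0], shortening makes this slot exactly as long as the batch of GAC+, so its
   companions pass the test [p]. *)
have ptj : pt' i0 = mint j.
  by have /andP[/minn_idPr] := allP fA _ jA.
have eqA' : perm_eq (unzip1 A0 ++ unzip1 A1) s.
  rewrite -(perm_cons j) -(permPr eqA) -map_cat.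
  have : perm_eq ((j, i0) :: A0 ++ A1) A.
    by rewrite -cat_cons -(permPr (permEl (perm_filterC in0 A))) perm_cat2r
      perm_sym perm_to_rem.
  by move/(perm_map fst).
have [] := @extract_exchange pt' (mint j) c.-1 s [::] (unzip1 A0) A1.
- by move=> i; rewrite geq_minr.
- exact: sort_s'.
- apply/allP=> _ /mapP[[x i] /mem_rem xi ->].
  move: xi; rewrite mem_filter => /andP[/eqP/= -> xA].
  by have := allP fA' _ xA; rewrite /fits /= ptj.
- rewrite size_map size_rem // size_filter -!subn1 leq_sub2r //.
  by have := cA i0; rewrite /unzip2 count_map.
- by [].
- by apply/allP=> z; rewrite mem_filter => /andP[_ /(allP fA')].
- by [].
move=> A' [eA' fitA' cA'].
case Ex: (extract p c.-1 s) => [t u] /=.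
have eu : u = (extract p c.-1 s).2 by rewrite Ex.
have et : t = (extract p c.-1 s).1 by rewrite Ex.
have cA'' i : count_mem i (unzip2 A') <= count_mem i (unzip2 A).
  apply: leq_trans (cA' i) _; rewrite /unzip2 !count_map count_filter.
  by apply: sub_count => z /andP[].
have [|||z zA'||size_le sum_le] := IH u pt' A' (rem i0 E).
- have := subseq_sorted nonincr_trans (extract_subseq p c.-1 s) sort_s'.
  by rewrite -eu.
- by rewrite eu.
- by [].
- have z2A' : z.2 \in unzip2 A' by apply: map_f.
  have z2A1 : z.2 \in unzip2 A1.
    by rewrite -has_pred1 has_count (leq_trans _ (cA' _)) // -has_count has_pred1.
  case/mapP: z2A1 => w; rewrite mem_filter /= => /andP[wi0 wA] ->.
  have := AE _ wA; rewrite (perm_mem (perm_to_rem i0E)) inE.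
  by rewrite /in0 in wi0; rewrite (negbTE wi0).
- by move=> i; apply: leq_trans (cA'' i) (cA i).
split; first by rewrite (leq_ltn_trans size_le) // size_rem // prednK //; case: (E) i0E.
rewrite big_cons (perm_big _ (perm_to_rem i0E)) [leqRHS]big_cons; apply: leq_add.
  apply: leq_trans (_ : mint j <= _); last by rewrite -ptj geq_minl.
  rewrite big_cons geq_max leqnn /= et; apply/bigmax_leqP_seq => x xt _.
  by case/andP: (allP (extract_all p c.-1 s) x xt).
by apply: leq_trans sum_le _; apply: leq_sum => i _; rewrite geq_minl.
Qed.

End UnitJobs.

Lemma bigminn_le (J : eqType) (r : seq J) (P : pred J) (F : J -> nat) x j :
  j \in r -> P j -> \big[minn/x]_(i <- r | P i) F i <= F j.
Proof.
elim: r => // i r IHr; rewrite inE big_cons => /predU1P[-> Pi|jr Pj].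
  by rewrite Pi geq_minl.
case: ifP => _; last exact: IHr.
by rewrite geq_min IHr ?orbT.
Qed.

(** * Large and small jobs in a feasible solution *)

Section OvenScheduling.

Set Implicit Arguments.
Unset Strict Implicit.
Unset Printing Implicit Defensive.

Variables (R : realFieldType) (k n a q l : nat) (o : instance R k n a q l).
Variables (sol : solution k n a) (hsol : feasible o sol) (r : 'I_a).

Lemma mem_all_batches B :
  reflect (exists m, B \in sol m) (B \in all_batches sol).
Proof.
apply: (iffP flatten_mapP) => [[m _ Bm]|[m Bm]]; exists m => //.
by rewrite mem_enum.
Qed.

(** A second job would also have attribute [r], hence size at least [min_size o r]. Together with
    [j] it would exceed the capacity of every machine eligible for [j], among them the one running
    [B]. *)
Lemma large_job_alone B j : B \in all_batches sol ->
  j \in large_jobs o r -> j \in bjobs B -> bjobs B = [set j].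
Proof.
move=> /mem_all_batches[m Bm]; rewrite inE => /andP[/eqP jr large] jB.
apply/eqP; rewrite eqEsubset sub1set jB andbT; apply/subsetP=> i iB.
rewrite inE; apply: contraLR large => ij; rewrite -leqNgt.
have ir : jattr o i = r by rewrite (feas_attr hsol Bm iB) -(feas_attr hsol Bm jB).
have min_le : min_size o r <= jsize o i.
  by apply: bigminn_le; rewrite ?mem_index_enum ?ir.
have em := feas_eligible hsol Bm jB.
apply: leq_trans _ (leq_bigmax_cond (F := capacity o) m em).
apply: leq_trans _ (feas_capacity hsol Bm).
by rewrite (bigD1 j) //= leq_add2l (bigD1 i) /= ?iB ?ij // (leq_trans min_le) ?leq_addr.
Qed.

Definition no_large (B : batch n a) := [disjoint bjobs B & large_jobs o r].

(** Used with [f] and [g] both 1 for the number of batches, and with [mint] and [ptime] for the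
    processing times. Double counting over pairs of a job and its unique batch leaves at most one
    large job per batch. *)
Lemma sum_large_le (f : 'I_n -> nat) (g : batch n a -> nat) :
    {in all_batches sol, forall B j, j \in bjobs B -> f j <= g B} ->
  \sum_(j in large_jobs o r) f j <=
    \sum_(B <- all_batches sol | (battr B == r) && ~~ no_large B) g B.
Proof.
move=> fg.
have -> : \sum_(j in large_jobs o r) f j =
    \sum_(B <- all_batches sol) \sum_(j in large_jobs o r | j \in bjobs B) f j.
  transitivity (\sum_(j in large_jobs o r)
      \sum_(B <- all_batches sol | j \in bjobs B) f j).
    apply: eq_bigr => j _.
    by rewrite big_const_seq iter_addn_0 (feas_partition hsol) muln1.
  exact: (exchange_big_dep predT).
rewrite [leqRHS]big_mkcond big_seq [leqRHS]big_seq; apply: leq_sum => B BL.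
have [noB|] := boolP (no_large B).
  rewrite big1 // => j /andP[jl jB].
  by rewrite (disjointFr noB jB) in jl.
rewrite andbT => /pred0Pn[j /= /andP[jB jl]].
have eB := large_job_alone BL jl jB.
have -> : battr B == r.
  have /mem_all_batches[m Bm] := BL; rewrite -(feas_attr hsol Bm jB).
  by move: jl; rewrite inE => /andP[].
rewrite (bigD1 j) /= ?jl // big1 ?addn0; first exact: fg.
by move=> i /andP[/andP[_]]; rewrite eB inE => ->.
Qed.

(** The default of [head] is never reached in a feasible solution, where each job lies in exactly
    one batch. *)
Definition batch_of (j : 'I_n) : batch n a :=
  head (Batch set0 0 r) [seq B <- all_batches sol | j \in bjobs B].

Lemma batch_ofP j : batch_of j \in all_batches sol /\ j \in bjobs (batch_of j).
Proof.
have : batch_of j \in [seq B <- all_batches sol | j \in bjobs B].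
  have := feas_partition hsol j; rewrite -size_filter /batch_of.
  by case: filter => // B L _; rewrite mem_head.
by rewrite mem_filter => /andP[].
Qed.

Lemma mem_unit_copies (J : {set 'I_n}) j : j \in unit_copies o J -> j \in J.
Proof.
case/flatten_mapP=> i; rewrite mem_enum => iJ.
by rewrite mem_nseq => /andP[_ /eqP ->].
Qed.

Lemma count_unit_copies (J : {set 'I_n}) (p : pred 'I_n) :
  count p (unit_copies o J) = \sum_(j in J | p j) jsize o j.
Proof.
rewrite /unit_copies count_flatten -map_comp sumnE big_map big_enum /=.
rewrite big_mkcondr; apply: eq_bigr => j _ /=.
by rewrite count_nseq; case: (p j); rewrite ?mul1n.
Qed.

(** The slots are the batches themselves, and all copies of [j] go to [batch_of j]. A slot then
    holds at most the total job size of its batch, so at most [max_capacity o] copies. *)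
Lemma small_jobs_bound (s : seq 'I_n) : gac_order o (small_jobs o r) s ->
  let E := [seq B <- all_batches sol | (battr B == r) && no_large B] in
  GACb o (max_capacity o) s <= size E /\
  GACp o (max_capacity o) s <= \sum_(B <- E) ptime o B.
Proof.
case/andP=> perm_s sort_s E.
pose A := [seq (j, batch_of j) | j <- s].
have eA1 : unzip1 A = s by rewrite /unzip1 -map_comp map_id.
have mem_s j : j \in s -> j \in small_jobs o r.
  by rewrite (perm_mem perm_s); apply: mem_unit_copies.
apply: (@gac_rec_optimal _ _ (mint o) (maxt o) _ _ _ (@ptime _ _ _ _ _ _ o) A) => //.
- by rewrite eA1.
- apply/allP=> _ /mapP[j js ->]; rewrite /fits /=.
  have [/mem_all_batches[m Bm] jB] := batch_ofP j.
  by rewrite (feas_maxt hsol Bm jB) andbT /ptime (leq_bigmax_cond (F := mint o) j).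
- move=> _ /mapP[j /mem_s jS ->] /=.
  have [BL jB] := batch_ofP j.
  move: jS; rewrite in_setD inE => /andP[jl jr]; rewrite mem_filter BL andbT.
  have /mem_all_batches[m Bm] := BL.
  rewrite -(feas_attr hsol Bm jB) jr /=.
  apply/pred0P=> i /=; apply/negP=> /andP[iB il].
  have eB := large_job_alone BL il iB.
  by move: jB; rewrite eB inE => /eqP eji; rewrite eji il in jl.
- move=> B; rewrite /unzip2 -map_comp count_map (permP perm_s) count_unit_copies.
  have [BL|nBL] := boolP (B \in all_batches sol); last first.
    rewrite big1 // => j /andP[_ /eqP/= eB].
    by case: (batch_ofP j); rewrite eB (negbTE nBL).
  have /mem_all_batches[m Bm] := BL.
  apply: leq_trans _ (leq_bigmax (F := capacity o) m).
  apply: leq_trans _ (feas_capacity hsol Bm).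
  rewrite [leqLHS]big_mkcond [leqRHS]big_mkcond; apply: leq_sum => j _.
  case: ifP => // /andP[_ /eqP/= eB].
  by case: (batch_ofP j); rewrite eB => _ ->.
Qed.

End OvenScheduling.

Theorem mainTheorem2 (R : realFieldType) (k n a q l : nat)
    (o : instance R k n a q l) (sol : solution k n a) (hsol : feasible o sol)
    (r : 'I_a) (s : seq 'I_n) (hs : gac_order o (small_jobs o r) s) :
  num_batches sol r >= #|large_jobs o r| + GACb o (max_capacity o) s /\
  total_ptime o sol r >=
    \sum_(j in large_jobs o r) mint o j + GACp o (max_capacity o) s.
Proof.
have [small_b small_p] := small_jobs_bound hsol hs.
split.
  rewrite /num_batches -sum1_count (bigID (no_large o r)) /= addnC.
  apply: leq_add; first by rewrite -big_filter sum1_size.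
  by rewrite -sum1_card; apply: sum_large_le.
rewrite /total_ptime (bigID (no_large o r)) /= addnC.
apply: leq_add; first by rewrite -big_filter.
apply: sum_large_le => // B _ j jB.
exact: (leq_bigmax_cond (F := mint o) j).
Qed.
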